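(* $h_{2\times 4}\le 191.35$.
   Context: A $2\times 4$ block is a subset of $\mathbb{R}^3$ of the form $[x,x+2]\times[y,y+4]\times[z,z+1]$ or $[x,x+4]\times[y,y+2]\times[z,z+1]$ with $x,y,z\in\mathbb{Z}$. A building is a finite set of blocks with pairwise disjoint interiors. Two blocks of a building are attached if their $z$-coordinates differ by exactly $1$ and their projections to the $xy$-plane overlap in a set with nonempty interior (i.e. at least one stud of the lower block is inserted into the upper block). A building is contiguous if the graph on its blocks given by attachment is connected. Two buildings are identified if one is mapped onto the other by a composition of translations of $\mathbb{R}^3$ and rotations about vertical axes (rotations in the $xy$-plane, by multiples of $90^\circ$). $T_{2\times 4}(n)$ denotes the number of contiguous buildings consisting of exactly $n$ such blocks, counted up to this identification. The entropy is $s_{2\times 4}=\lim_{n\to\infty}\frac{\log(T_{2\times 4}(n))}{n}$ (this limit exists and is finite), and $h_{2\times 4}=\exp(s_{2\times 4})$. *)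

(* Defs.v *)
From HB Require Import structures.
From mathcomp Require Import all_boot all_order all_algebra finmap.
From mathcomp Require Import all_classical all_reals all_analysis.

Set Implicit Arguments.
Unset Strict Implicit.
Unset Printing Implicit Defensive.

Import Order.TTheory GRing.Theory Num.Theory.
Import numFieldNormedType.Exports.

Local Open Scope classical_set_scope.
Local Open Scope ring_scope.

(* A block is coded by its orientation and its corner of least coordinates;
   [body] below is the subset of space it denotes. As [body] is injective,
   finite sets of codes and finite sets of blocks are the same thing. *)
Record block := Block { lengthwise_x : bool; xb : int; yb : int; zb : int }.

Definition block_code (b : block) : bool * int * int * int :=
  (lengthwise_x b, xb b, yb b, zb b).
Definition block_decode (c : bool * int * int * int) : block :=
  let: (o, x, y, z) := c in Block o x y z.
Lemma block_codeK : cancel block_code block_decode.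
Proof. by case. Qed.
HB.instance Definition _ := Countable.copy block (can_type block_codeK).

Definition xlen (b : block) : int := if lengthwise_x b then 4 else 2.
Definition ylen (b : block) : int := if lengthwise_x b then 2 else 4.

(* Points of space are triples ((x, y), z). *)
Definition body (R : realType) (b : block) : set (R * R * R) :=
  [set p | [/\ (xb b)%:~R <= p.1.1 <= (xb b + xlen b)%:~R,
               (yb b)%:~R <= p.1.2 <= (yb b + ylen b)%:~R &
               (zb b)%:~R <= p.2 <= (zb b + 1)%:~R]].
Arguments body : clear implicits.

Definition shadow (R : realType) (b : block) : set (R * R) := fst @` body R b.
Arguments shadow : clear implicits.

Definition is_building (R : realType) (B : {fset block}) : Prop :=
  forall b c, b \in B -> c \in B -> b != c ->
    interior (body R b) `&` interior (body R c) = set0.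

Definition attached (R : realType) (b c : block) : Prop :=
  `|zb b - zb c| = 1 /\ interior (shadow R b `&` shadow R c) !=set0.

Definition contiguous (R : realType) (B : {fset block}) : Prop :=
  forall b c : B, connect [rel u v : B | `[< attached R (val u) (val v) >]] b c.

Definition translation (R : realType) (t p : R * R * R) : R * R * R :=
  (p.1.1 + t.1.1, p.1.2 + t.1.2, p.2 + t.2).

(* Rotation by 90 degrees about the vertical axis through (a.1, a.2). *)
Definition quarter_turn (R : realType) (a : R * R) (p : R * R * R) :
    R * R * R :=
  (a.1 - (p.1.2 - a.2), a.2 + (p.1.1 - a.1), p.2).

Inductive motion (R : realType) : (R * R * R -> R * R * R) -> Prop :=
| motion_translation t : motion (translation t)
| motion_quarter_turn a : motion (quarter_turn a)
| motion_comp f g : motion f -> motion g -> motion (f \o g).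

Definition congruent (R : realType) (B C : {fset block}) : Prop :=
  exists2 g : R * R * R -> R * R * R, motion g &
    [set g @` body R b | b in [set` B]] = [set body R c | c in [set` C]].

Definition contiguous_buildings (R : realType) (n : nat) : set {fset block} :=
  [set B | [/\ is_building R B, contiguous R B & #|` B| = n]].

(* The number of congruence classes. *)
Definition T24 (R : realType) (n : nat) : nat :=
  #|` fset_set [set [set C | congruent R B C] | B in contiguous_buildings R n]|.

Definition s24 (R : realType) : R :=
  lim ((fun n : nat => ln (T24 R n)%:R / n%:R : R) @ \oo).

Definition h24 (R : realType) : R := expR (s24 R).

(* Main.v *)
Require Import Defs.
From mathcomp Require Import all_boot all_order all_algebra finmap.
From mathcomp Require Import all_classical all_reals all_analysis.
From mathcomp Require Import zify lra.
Import Order.TTheory GRing.Theory Num.Theory.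
Import numFieldNormedType.Exports.
Local Open Scope ring_scope.

(* Explore a building block by block, starting from a lowest block: processing
   a block [a] means revealing the blocks attached to [a] that are not known
   yet. Those above [a] are pairwise disjoint blocks among the 46 that overlap
   [a], and similarly below; moreover, on the side where [a] was discovered,
   they are disjoint from the block that led to [a]. Giving weight [t] to each
   revealed block, a step thus contributes a factor at most [P t * Q t], where
   [P] and [Q] enumerate by size the families of disjoint blocks without and
   with that last restriction. Hence there are at most [(P t * Q t / t) ^+ n]
   buildings rooted at a given block. At [t = 1 / 55], nearly optimal, the base
   is below 176.8. *)

(** * Overlap in integer coordinates, and families of disjoint blocks *)

Definition overlap (b c : block) : bool :=
  [&& xb b < xb c + xlen c, xb c < xb b + xlen b,
      yb b < yb c + ylen c & yb c < yb b + ylen b].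

Definition clash (b c : block) : bool := (zb b == zb c) && overlap b c.

Definition adjacent (b c : block) : bool :=
  (`|zb b - zb c| == 1) && overlap b c.

Fixpoint packings (l : seq block) : seq (seq block) :=
  if l is c :: l' then
    let r := packings l' in r ++ [seq c :: s | s <- r & ~~ has (clash c) s]
  else [:: [::]].

(* [c] is given by its position relative to [a]; only its orientation and
   horizontal coordinates matter. *)
Definition place (a : block) (e : int) (c : block) : block :=
  Block (lengthwise_x c) (xb a + xb c) (yb a + yb c) (zb a + e).

Definition near_offsets : seq int := [seq i%:Z - 3 | i <- iota 0 7].

Definition overlappers (o : bool) : seq block :=
  [seq c <- [seq Block o' u.1 u.2 0 | o' <- [:: true; false],
              u <- [seq (x, y) | x <- near_offsets, y <- near_offsets]]
     | overlap (Block o 0 0 0) c].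

Definition fits (q : seq nat) (l : seq (seq block)) : bool :=
  all (fun s => size s < size q)%N l &&
  all (fun k => count (fun s => size s == k) l <= nth 0 q k)%N
      (iota 0 (size q)).

(* Entry [k] bounds the number of families of [k] disjoint blocks on one side of
   a block; [parent_profile] takes the maximum over the 46 places of a parent on
   that side. *)
Definition free_profile : seq nat := [:: 1; 46; 480; 1288; 1072; 272; 16].
Definition parent_profile : seq nat := [:: 1; 30; 174; 276; 144; 16].

Lemma fits_free (o : bool) : fits free_profile (packings (overlappers o)).
Proof. by case: o; vm_compute. Qed.

Lemma fits_parent (o : bool) (p : block) : p \in overlappers o ->
  fits parent_profile (packings [seq c <- overlappers o | ~~ clash p c]).
Proof.
have/allP H : all (fun p => fits parent_profile
    (packings [seq c <- overlappers o | ~~ clash p c])) (overlappers o).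
  by case: o; vm_compute.
exact: H.
Qed.

Lemma clash_place (a : block) (e : int) (c d : block) :
  zb c = zb d -> clash (place a e c) (place a e d) = clash c d.
Proof.
by move=> zcd; rewrite /clash /overlap /place /xlen /ylen /= zcd !eqxx /=; lia.
Qed.

(** As [clash] is reflexive, disjointness reads: clashing blocks are equal. A kept head therefore
    clashes with no later kept block, which would repeat it in [l]. *)
Lemma filter_packings (P : pred block) (l : seq block) : uniq l ->
  (forall b c, b \in l -> c \in l -> P b -> P c -> clash b c -> b = c) ->
  [seq x <- l | P x] \in packings l.
Proof.
elim: l => [|c l IH] //= /andP[cl ul] Pl.
have {}IH : [seq x <- l | P x] \in packings l.
  by apply: IH => // x y xl yl; apply: Pl; rewrite in_cons ?xl ?yl orbT.
rewrite mem_cat; case: ifP => Pc; last by rewrite IH.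
apply/orP; right; apply: map_f; rewrite mem_filter IH andbT.
apply/hasPn => x; rewrite mem_filter => /andP[Px xl].
apply/negP => /Pl; rewrite !in_cons eqxx xl orbT => /(_ isT isT Pc Px) xc.
by rewrite xc xl in cl.
Qed.

Lemma packings_map (f : block -> block) (l : seq block) :
  {in l &, forall c d, clash (f c) (f d) = clash c d} ->
  packings (map f l) = map (map f) (packings l).
Proof.
move=> fl.
(* The hypothesis on [f] holds only within [l], so members of a packing are first traced back to
   [l]. *)
have sub : forall l' s, s \in packings l' -> {subset s <= l'}.
  elim=> [|c l' IH] s /=; first by rewrite inE => /eqP ->.
  rewrite mem_cat => /orP[/IH sl x xs|/mapP[s']]; first by rewrite inE sl ?orbT.
  rewrite mem_filter => /andP[_ /IH sl] -> x; rewrite !inE => /orP[->//|/sl ->].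
  by rewrite orbT.
elim: l fl => [|c l IH] //= fl.
rewrite IH; last by move=> x y xl yl; apply: fl; rewrite inE ?xl ?yl orbT.
rewrite map_cat filter_map -!map_comp; congr (_ ++ _).
rewrite (@eq_in_filter _ _ (fun s => ~~ has (clash c) s)) //= => s /sub sl.
rewrite has_map; congr (~~ _); apply: eq_in_has => x /sl xl /=.
by rewrite fl ?inE ?eqxx ?xl ?orbT.
Qed.

(** * Generating polynomials of families by size *)

Definition weight {R : realType} (t : R) (l : seq (seq block)) : R :=
  \sum_(s <- l) t ^+ size s.

Lemma fits_weight (R : realType) (t : R) (q : seq nat) (l : seq (seq block)) :
  0 <= t -> fits q l ->
  weight t l <= \sum_(k < size q) (nth 0%N q k)%:R * t ^+ k.
Proof.
move=> t0 /andP[/allP lq /allP cq].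
have -> : weight t l =
    \sum_(k < size q) (count (fun s => size s == k) l)%:R * t ^+ k.
  under [RHS]eq_bigr do rewrite -sum1_count natr_sum mulr_suml.
  under [RHS]eq_bigr do rewrite big_mkcond.
  (* After the exchange, [s] contributes only at [k = size s], which is in range by [fits]. *)
  rewrite exchange_big /weight !big_seq /=; apply: eq_bigr => s /lq sq.
  rewrite (bigD1 (Ordinal sq)) //= eqxx mul1r big1 ?addr0 // => k ks.
  by case: eqP => // sk; move/eqP: ks; case; apply: val_inj.
apply: ler_sum => k _; apply: ler_wpM2r; first exact: exprn_ge0.
by rewrite ler_nat; apply: cq; rewrite mem_iota /=.
Qed.

Lemma weight_cat (R : realType) (t : R) (l1 l2 : seq (seq block)) :
  weight t [seq s1 ++ s2 | s1 <- l1, s2 <- l2] = weight t l1 * weight t l2.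
Proof.
rewrite /weight big_allpairs_dep mulr_suml; apply: eq_bigr => s1 _.
by rewrite mulr_sumr; apply: eq_bigr => s2 _; rewrite size_cat exprD.
Qed.

(** The enumeration misses nothing: sides have length at most 4, so corners of overlapping blocks
    differ by at most 3 along each axis. *)
Lemma overlappersP (o : bool) (c : block) : zb c = 0 ->
  (c \in overlappers o) = overlap (Block o 0 0 0) c.
Proof.
case: c => o' x y z /= ->; rewrite mem_filter; apply/andb_idr => ov.
suff [xN yN] : x \in near_offsets /\ y \in near_offsets.
  by apply/allpairsP; exists (o', (x, y)); split=> //;
     [case: (o') | apply/allpairsP; exists (x, y)].
have near : forall u : int, -4 < u < 4 -> u \in near_offsets.
  move=> u u4; apply/mapP; exists (absz (u + 3)); last lia.
  by rewrite mem_iota; lia.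
by move: ov; rewrite /overlap /xlen /ylen /= => ov; split; apply: near;
   case: (o) (o') ov => [] []; lia.
Qed.

(** * Neighbours of a block in arbitrary position *)

Definition neighbors (a : block) (e : int) : seq block :=
  [seq place a e c | c <- overlappers (lengthwise_x a)].

Definition unplace (a c : block) : block :=
  Block (lengthwise_x c) (xb c - xb a) (yb c - yb a) 0.

Lemma unplaceK (a c : block) : place a (zb c - zb a) (unplace a c) = c.
Proof. by case: c => o x y z; rewrite /place /unplace /=; congr Block; lia. Qed.

Lemma overlappers_z (o : bool) (c : block) : c \in overlappers o -> zb c = 0.
Proof.
by rewrite mem_filter => /andP[_ /allpairsP[[? [? ?]] [_ _ ->]]].
Qed.

Lemma place_inj (a : block) (e : int) :
  {in overlappers (lengthwise_x a) &, injective (place a e)}.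
Proof.
move=> [b x y z] [b' x' y' z'] /overlappers_z /= -> /overlappers_z /= ->.
by case=> -> /addrI -> /addrI ->.
Qed.

Lemma neighborsP (a : block) (e : int) (c : block) :
  (c \in neighbors a e) = (zb c == zb a + e) && overlap a c.
Proof.
apply/mapP/andP => [[d dO ->]|[/eqP zc ov]].
  move: (dO); rewrite (overlappersP _ _ (overlappers_z _ _ dO)) //= => ov.
  split=> //.
  by move: ov; rewrite /overlap /place /xlen /ylen /=; lia.
exists (unplace a c); last by rewrite -[LHS](unplaceK a) zc; congr place; lia.
rewrite overlappersP //; move: ov.
by rewrite /overlap /unplace /xlen /ylen /=; lia.
Qed.

Lemma neighbors_uniq (a : block) (e : int) : uniq (neighbors a e).
Proof.
rewrite map_inj_in_uniq; last exact: place_inj.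
by case: (lengthwise_x a); vm_compute.
Qed.

(** Moves [a] to the origin, where the finite computations [fits_free] and [fits_parent] apply. *)
Lemma weight_neighbors (R : realType) (t : R) (a : block) (e : int)
    (P : pred block) :
  weight t (packings [seq c <- neighbors a e | P c]) =
  weight t (packings [seq c <- overlappers (lengthwise_x a) | P (place a e c)]).
Proof.
rewrite filter_map packings_map.
  by rewrite /weight big_map; apply: eq_bigr => s _; rewrite size_map.
move=> c d; rewrite mem_filter => /andP[_ /overlappers_z zc].
rewrite mem_filter => /andP[_ /overlappers_z zd].
by apply: clash_place; rewrite zc zd.
Qed.

(** A parent [p] of [a] lies at one of the two heights, so only one of the filters removes
    anything. *)
Definition growths (p a : block) : seq (seq block) :=
  [seq s1 ++ s2 | s1 <- packings [seq c <- neighbors a 1 | ~~ clash p c],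
                  s2 <- packings [seq c <- neighbors a (-1) | ~~ clash p c]].

Definition growth_weight (R : realType) : R :=
  (\sum_(k < 7) (nth 0%N free_profile k)%:R * 55^-1 ^+ k) *
  (\sum_(k < 6) (nth 0%N parent_profile k)%:R * 55^-1 ^+ k).

Lemma weight_ge0 (R : realType) (t : R) (l : seq (seq block)) :
  0 <= t -> 0 <= weight t l.
Proof. by move=> t0; apply: sumr_ge0 => s _; exact: exprn_ge0. Qed.

Lemma growth_weight_bound (R : realType) :
  55^-1 <= growth_weight R :> R /\ 55 * growth_weight R <= 191 + 35 / 100.
Proof.
by rewrite /growth_weight !big_ord_recr !big_ord0 /=; split; lra.
Qed.

Lemma weight_growths (R : realType) (p a : block) : adjacent p a ->
  weight (55^-1 : R) (growths p a) <= growth_weight R.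
Proof.
move=> /andP[pz pa]; have t0 : 0 <= 55^-1 :> R by rewrite invr_ge0.
have free e : zb p != zb a + e ->
    weight (55^-1 : R) (packings [seq c <- neighbors a e | ~~ clash p c]) <=
    \sum_(k < 7) (nth 0%N free_profile k)%:R * 55^-1 ^+ k.
  move=> pe; rewrite weight_neighbors (@eq_in_filter _ _ predT) => [|c _].
    by rewrite filter_predT; apply: (fits_weight _ _ free_profile) => //;
       exact: fits_free.
  by rewrite /clash /= (negbTE pe).
have parent e : zb p = zb a + e ->
    weight (55^-1 : R) (packings [seq c <- neighbors a e | ~~ clash p c]) <=
    \sum_(k < 6) (nth 0%N parent_profile k)%:R * 55^-1 ^+ k.
  move=> pe; rewrite weight_neighbors.
  (* Seen from [a], the parent is itself one of the 46 overlapping positions. *)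
  rewrite (@eq_in_filter _ _ (fun c => ~~ clash (unplace a p) c)) => [|c cO].
    apply: (fits_weight _ _ parent_profile) => //; apply: fits_parent.
    rewrite overlappersP //; move: pa.
    by rewrite /overlap /unplace /xlen /ylen /=; lia.
  rewrite -(clash_place a e (unplace a p)) ?(overlappers_z _ _ cO) //.
  rewrite -[in LHS](unplaceK a p) pe.
  by have -> : zb a + e - zb a = e by lia.
rewrite weight_cat /growth_weight.
have [p1|p1] : zb p = zb a + 1 \/ zb p = zb a - 1 by move/eqP: pz; lia.
  rewrite mulrC; apply: ler_pM; rewrite ?weight_ge0 ?parent ?free //; lia.
by apply: ler_pM; rewrite ?weight_ge0 ?parent ?free //; lia.
Qed.

(** * Exploration of a connected family of blocks *)

Definition spaced (B : {fset block}) : Prop :=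
  forall b c, b \in B -> c \in B -> clash b c -> b = c.

(** Connectedness as an induction principle, to be applied to the set of processed blocks without
    handling paths. *)
Definition linked (B : {fset block}) : Prop :=
  forall (r : block) (W : pred block), r \in B -> W r ->
    (forall v b, W v -> b \in B -> adjacent v b -> W b) -> {subset B <= W}.

(** Filtering a fixed list gives the revealed blocks in the order used by [packings], so that the
    result is literally a member of [growths]. *)
Definition fresh (B K : {fset block}) (a : block) : seq block :=
  [seq c <- neighbors a 1 ++ neighbors a (-1) | (c \in B) && (c \notin K)].

Lemma mem_fresh (B K : {fset block}) (a c : block) :
  (c \in fresh B K a) = [&& adjacent a c, c \in B & c \notin K].
Proof.
rewrite mem_filter mem_cat !neighborsP andbC; congr (_ && _).
rewrite /adjacent -andb_orl; congr (_ && _); lia.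
Qed.

Lemma fresh_uniq (B K : {fset block}) (a : block) : uniq (fresh B K a).
Proof.
apply: filter_uniq; rewrite cat_uniq !neighbors_uniq andbT /=.
by apply/hasPn => c; rewrite !neighborsP => /andP[/eqP -> _]; lia.
Qed.

(** Blocks of [B] clashing with the parent are already known, so the parent filter discards no fresh
    block. *)
Lemma fresh_growths (B K : {fset block}) (p a : block) : spaced B ->
  (forall c, c \in B -> clash p c -> c \in K) -> fresh B K a \in growths p a.
Proof.
move=> sB pB; rewrite /fresh filter_cat.
have side e : [seq c <- neighbors a e | (c \in B) && (c \notin K)]
    \in packings [seq c <- neighbors a e | ~~ clash p c].
  rewrite -(_ : [seq c <- [seq c <- neighbors a e | ~~ clash p c]
             | (c \in B) && (c \notin K)] =
             [seq c <- neighbors a e | (c \in B) && (c \notin K)]).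
    apply: filter_packings; first exact/filter_uniq/neighbors_uniq.
    by move=> b c _ _ /andP[bB _] /andP[cB _]; exact: sB.
  rewrite -filter_predI; apply: eq_filter => c /=; apply/andb_idr => /andP[cB].
  by apply: contra; exact: pB.
by apply: allpairs_f; exact: side.
Qed.

Lemma size_fibers (T U : eqType) (f : T -> U) (X : seq T) (l : seq U) :
  (forall x, x \in X -> f x \in l) ->
  (size X <= \sum_(u <- l) size [seq x <- X | f x == u])%N.
Proof.
move=> fl; under eq_bigr do rewrite size_filter -sum1_count big_mkcond.
rewrite exchange_big /= -sum1_size !big_seq; apply: leq_sum => x /fl.
by move=> /path.splitPr[l1 l2]; rewrite big_cat big_cons eqxx /= addnCA.
Qed.

Local Open Scope fset_scope.

(** With nothing left to process, [V] is closed under adjacency, hence is the whole building by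
    [linked]: [X] has at most one member. *)
Lemma explore_done (R : realType) (m : nat) (r : block) (V A : {fset block})
    (X : seq {fset block}) :
  A = fset0 -> uniq X -> r \in V `|` A ->
  (forall B, B \in X ->
     [/\ spaced B, linked B, #|` B| = (#|` V| + m)%N, V `|` A `<=` B &
         forall v b, v \in V -> b \in B -> adjacent v b -> b \in V `|` A]) ->
  (size X)%:R * 55^-1 ^+ m <= growth_weight R ^+ m * 55^-1 ^+ #|` A| :> R.
Proof.
move=> ->; rewrite fsetU0 => uX rV XB.
have [tw _] := growth_weight_bound R.
have t0 : 0 <= 55^-1 :> R by rewrite invr_ge0.
have XV B : B \in X -> B = V.
  move=> /XB[_ lB _ VB cl]; apply/eqP; rewrite eqEfsubset VB andbT.
  by apply/fsubsetP; apply: (lB r (mem V)) => //; exact: (fsubsetP VB).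
have X1 : (size X <= 1)%N.
  by rewrite -(size_nseq 1 V); apply: uniq_leq_size => // B /XV ->; rewrite inE.
rewrite cardfs0 mulr1; apply: le_trans (_ : 1 * 55^-1 ^+ m <= _).
  by apply: ler_wpM2r; [exact: exprn_ge0|rewrite (ler_nat _ _ 1)].
by rewrite mul1r; apply: lerXn2r => //; rewrite nnegrE // (le_trans t0 tw).
Qed.

(* [V] holds the processed blocks of the buildings in [X] and [A] the blocks
   known but not processed; [p] is what led to [a], and need not be in the
   buildings. *)
Lemma explore (R : realType) (m : nat) (r : block) (V A : {fset block})
    (X : seq {fset block}) :
  uniq X -> r \in V `|` A -> [disjoint V & A] ->
  (forall B, B \in X ->
     [/\ spaced B, linked B, #|` B| = (#|` V| + m)%N, V `|` A `<=` B &
         forall v b, v \in V -> b \in B -> adjacent v b -> b \in V `|` A]) ->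
  (forall a, a \in A -> exists2 p, adjacent p a &
     forall B c, B \in X -> c \in B -> clash p c -> c \in V) ->
  (size X)%:R * 55^-1 ^+ m <= growth_weight R ^+ m * 55^-1 ^+ #|` A| :> R.
Proof.
have [tw _] := growth_weight_bound R; set w := growth_weight R in tw *.
set t : R := 55^-1 in tw *; have t0 : 0 <= t by rewrite invr_ge0.
have w0 : 0 <= w := le_trans t0 tw.
elim: m V A X => [|m IH] V A X uX rVA VA XB Ap;
  have [A0|[a aA]] := fset_0Vmem A.
- exact: (explore_done R _ r V).
(* A building in [X] would have the size of [V] and yet contain the nonempty set [A] disjoint from
   [V]; so [X] is empty. *)
- case: X XB {uX Ap} => [|B X] XB; first by rewrite mul0r mul1r exprn_ge0.
  have [_ _ cB VAB _] := XB B (mem_head _ _).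
  have := fsubset_leq_card VAB; rewrite cB addn0 cardfsU (eqP VA : _ = fset0).
  rewrite cardfs0 subn0 -[leqRHS]addn0 leq_add2l leqn0 cardfs_eq0 => /eqP A0.
  by rewrite A0 in aA.
- exact: (explore_done R _ r V).
have [p pa pX] := Ap a aA.
pose K := V `|` A.
pose f B := fresh B K a.
have fX B : B \in X -> f B \in growths p a.
  move=> BX; have [sB _ _ _ _] := XB B BX.
  apply: fresh_growths => // c cB /pX pc.
  by rewrite in_fsetU (pc B).
(* The buildings for which [a] reveals exactly [s] form an instance of the induction hypothesis,
   with [a] processed and [s] pending. *)
have step s : (size [seq B <- X | f B == s])%:R * t ^+ m.+1 <=
    w ^+ m * t ^+ #|` A| * t ^+ size s.
  have [->|B0] : [seq B <- X | f B == s] = [::] \/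
      exists B, B \in [seq B <- X | f B == s].
    case: [seq _ <- X | _] => [|B l]; first by left.
    by right; exists B; exact: mem_head.
  - by rewrite mul0r !mulr_ge0 ?exprn_ge0.
  have us : uniq s.
    by case: B0 => B; rewrite mem_filter => /andP[/eqP <- _]; exact: fresh_uniq.
  have sE B c : B \in X -> f B == s ->
      (c \in s) = [&& adjacent a c, c \in B & c \notin K].
    by move=> _ /eqP <-; rewrite mem_fresh.
  have sK c : c \in s -> adjacent a c && (c \notin K).
    case: B0 => B; rewrite mem_filter => /andP[fB BX].
    by rewrite (sE B) // => /and3P[-> _ ->].
  pose A' := (A `\ a) `|` [fset x in s].
  have aV : a \notin V by apply: contraL aA; move/fdisjointP: VA; exact.
  have cA' : #|` A'|.+1 = (#|` A| + size s)%N.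
    rewrite cardfsU (_ : _ `&` _ = fset0) ?cardfs0 ?subn0.
      by rewrite card_fseq undup_id // [#|` A|](cardfsD1 a) aA.
    apply/eqP; change [disjoint A `\ a & [fset x in s]].
    apply/fdisjointP => x; rewrite !inE => /andP[_ xA].
    by apply: contraL xA => /sK; rewrite in_fsetU negb_or => /and3P[].
  have KV' : K `<=` (a |` V) `|` A'.
    apply/fsubsetP => x; rewrite !inE => /orP[->|->]; first by rewrite orbT.
    by case: (x == a); rewrite //= orbT.
  (* Processing [a] removes it from the pending blocks; the factor [t] so freed cancels the extra
     one in [t ^+ m.+1]. *)
  rewrite -mulrA -exprD -cA' [t ^+ m.+1]exprSr [t ^+ _.+1]exprSr !mulrA.
  apply: ler_wpM2r => //; apply: (IH (a |` V) A').
  - exact: filter_uniq.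
  - exact: (fsubsetP KV' _ rVA).
  - apply/fdisjointP => x; rewrite !inE negb_or => /orP[/eqP ->|xV].
      by rewrite eqxx /=; apply/negP => /sK; rewrite in_fsetU aA orbT andbF.
    apply/andP; split; last by apply/negP => /sK; rewrite in_fsetU xV andbF.
    by rewrite negb_and (fdisjointP VA) // orbT.
  - move=> B; rewrite mem_filter => /andP[fB BX].
    have [sB lB cB VAB clB] := XB B BX; split=> //.
    + by rewrite cB cardfsU1 aV addSn addnS.
    + apply/fsubsetP => x; rewrite !inE.
      move=> /orP[/orP[/eqP ->|xV]|/orP[/andP[_ xA]|]].
      * by apply: (fsubsetP VAB); rewrite inE aA orbT.
      * by apply: (fsubsetP VAB); rewrite inE xV.
      * by apply: (fsubsetP VAB); rewrite inE xA orbT.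
      * by rewrite (sE B) // => /and3P[].
    + move=> v b; rewrite in_fset1U => /orP[/eqP ->|vV] bB vb.
        have [bK|bK] := boolP (b \in K); first exact: (fsubsetP KV' _ bK).
        by rewrite !inE (sE B) // vb bB bK !orbT.
      by apply: (fsubsetP KV'); exact: clB vb.
  (* Old pending blocks keep their parent. A revealed block gets the parent [a]: by [spaced], a
     block of the building clashing with [a] is [a], now processed. *)
  - move=> b; rewrite !inE => /orP[/andP[_ bA]|bs].
      have [q qb qX] := Ap b bA; exists q => // B c.
      rewrite mem_filter => /andP[_ BX] cB /(qX B c BX cB) cV.
      by rewrite in_fset1U cV orbT.
    exists a; first by have /andP[] := sK b bs.
    move=> B c; rewrite mem_filter => /andP[_ BX] cB.
    have [sB _ _ VAB _] := XB B BX.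
    move=> /sB -> //; first by rewrite in_fset1U eqxx.
    by apply: (fsubsetP VAB); rewrite inE aA orbT.
(* Split [X] by the revealed list; the factors [t ^+ size s] add up to the weight of [growths p a],
   at most [w]. *)
apply: (@le_trans _ _ ((\sum_(s <- growths p a)
    size [seq B <- X | f B == s])%:R * t ^+ m.+1)).
  by apply: ler_wpM2r; [exact: exprn_ge0|rewrite ler_nat; exact: size_fibers].
rewrite natr_sum mulr_suml.
apply: le_trans (ler_sum _ (fun s _ => step s)) _.
rewrite -mulr_sumr exprSr -mulrA [w * _]mulrC mulrA.
apply: ler_wpM2l; first by rewrite mulr_ge0 ?exprn_ge0.
exact: weight_growths.
Qed.

Local Open Scope classical_set_scope.
Local Open Scope ring_scope.

(** The exploration starts with [r] alone pending; the weight of [r] is the remaining factor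
    [1 / 55]. *)
Lemma rooted_count (R : realType) (n : nat) (r : block) (X : seq {fset block}) :
  uniq X ->
  (forall B, B \in X -> [/\ spaced B, linked B, #|` B| = n, r \in B &
     forall b, b \in B -> zb r <= zb b]) ->
  (size X)%:R <= (55 * growth_weight R) ^+ n / 55.
Proof.
move=> uX XB.
have : (size X)%:R * 55^-1 ^+ n <=
    growth_weight R ^+ n * 55^-1 ^+ #|` [fset r]%fset| :> R.
  apply: (explore R n r fset0) => //.
  - by rewrite !inE eqxx.
  - by rewrite fdisjoint0X.
  - move=> B /XB[sB lB cB rB _]; split=> //.
    by rewrite fset0U fsub1set.
  (* No block lies below [r], so a fictitious block below it is a parent. *)
  - move=> a; rewrite inE => /eqP ->.
    exists (Block (lengthwise_x r) (xb r) (yb r) (zb r - 1)).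
      by rewrite /adjacent /overlap /xlen /ylen /=; case: (lengthwise_x r); lia.
    by move=> B c /XB[_ _ _ _ rz] /rz; rewrite /clash /=; lia.
rewrite cardfs1 expr1 exprVn ler_pdivrMr ?exprn_gt0 // => /le_trans; apply.
by rewrite mulrAC -exprMn [growth_weight R * _]mulrC.
Qed.

(** * From solid blocks to integer conditions *)

Lemma near_between (R : realType) (T : topologicalType) (f : T -> R) (p : T)
    (a b : R) : {for p, continuous f} -> a < f p < b ->
  \forall q \near p, a <= f q <= b.
Proof.
move=> cf /andP[af fb]; near=> q; apply/andP; split; apply: ltW; near: q.
  exact: (cvgr_gt (f p)).
exact: (cvgr_lt (f p)).
Unshelve. all: by end_near. Qed.

Lemma interior_body (R : realType) (b : block) (p : R * R * R) :
  (xb b)%:~R < p.1.1 < (xb b + xlen b)%:~R ->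
  (yb b)%:~R < p.1.2 < (yb b + ylen b)%:~R ->
  (zb b)%:~R < p.2 < (zb b + 1)%:~R -> interior (body R b) p.
Proof.
move=> px py pz.
have c1 : {for p, continuous (fun q : R * R * R => q.1.1)}.
  by apply: (@continuous_comp _ _ _ fst fst); exact: cvg_fst.
have c2 : {for p, continuous (fun q : R * R * R => q.1.2)}.
  by apply: (@continuous_comp _ _ _ fst snd); [exact: cvg_fst|exact: cvg_snd].
have c3 : {for p, continuous (fun q : R * R * R => q.2)} by exact: cvg_snd.
have := near_between _ _ _ _ _ _ c1 px.
have := near_between _ _ _ _ _ _ c2 py.
have := near_between _ _ _ _ _ _ c3 pz.
rewrite /interior => h3 h2 h1; near=> q; split; near: q.
- exact: h1.
- exact: h2.
- exact: h3.
Unshelve. all: by end_near. Qed.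

Lemma spaced_building (R : realType) (B : {fset block}) :
  is_building R B -> spaced B.
Proof.
move=> bB b c bB' cB /andP[/eqP zbc /and4P[x1 x2 y1 y2]].
apply/eqP/negPn/negP => bc.
have mid (u v s t : int) : u < v + t -> v < u + s -> 0 < s -> 0 < t ->
    (* The integer intervals share the unit interval starting at the larger left end; its midpoint
       is interior to both. *)
    exists m : R, (u%:~R < m < (u + s)%:~R) /\ (v%:~R < m < (v + t)%:~R).
  move=> uv vu s0 t0; pose k := Num.max u v.
  have h (i j : int) : i <= k -> k < j ->
      i%:~R < (k%:~R + 2^-1 : R) /\ (k%:~R + 2^-1 : R) < j%:~R.
    rewrite -(ler_int R) => ik; rewrite -lezD1 -(ler_int R) intrD => kj.
    by split; lra.
  exists (k%:~R + 2^-1).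
  by split; apply/andP; apply: h; rewrite /k; lia.
have lpos (d : block) : 0 < xlen d /\ 0 < ylen d.
  by rewrite /xlen /ylen; case: ifP.
have [[xb0 yb0] [xc0 yc0]] := (lpos b, lpos c).
have [x [xb_ xc]] := mid _ _ _ _ x1 x2 xb0 xc0.
have [y [yb_ yc]] := mid _ _ _ _ y1 y2 yb0 yc0.
have zz : (zb b < zb c + 1) /\ (zb c < zb b + 1) by rewrite zbc !ltrDl.
have [z [zb_ zc]] := mid _ _ _ _ zz.1 zz.2 ltr01 ltr01.
suff : (interior (body R b) `&` interior (body R c)) (x, y, z) by rewrite bB.
by split; apply: interior_body.
Qed.

(** A single common point of the closed shadows gives only weak inequalities; two common points on
    either side of an interior one, along a diagonal, make them strict. *)
Lemma attached_adjacent (R : realType) (b c : block) :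
  attached R b c -> adjacent b c.
Proof.
move=> [zbc [[x y] /nbhs_ballP[e /= e0 be]]]; rewrite /adjacent zbc eqxx /=.
have e2 : `|e / 2| < e by rewrite ger0_norm; lra.
have [[[[x1 y1] z1] [/= bx1 by1 _] [ex1 ey1]]
      [[[x1' y1'] z1'] [/= cx1 cy1 _] [ex1' ey1']]] :
    (shadow R b `&` shadow R c) (x + e / 2, y + e / 2).
  by apply: be; split; rewrite /= /ball /= opprD addNKr normrN.
have [[[[x2 y2] z2] [/= bx2 by2 _] [ex2 ey2]]
      [[[x2' y2'] z2'] [/= cx2 cy2 _] [ex2' ey2']]] :
    (shadow R b `&` shadow R c) (x - e / 2, y - e / 2).
  by apply: be; split; rewrite /= /ball /= opprB addrC subrK.
by rewrite /overlap -!(ltr_int R); apply/and4P; split; lra.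
Qed.

Lemma linked_contiguous (R : realType) (B : {fset block}) :
  contiguous R B -> linked B.
Proof.
move=> cB r W rB Wr cl b bB.
have /connectP[p] := cB [` rB] [` bB].
have : W (val [` rB]) by [].
move: [` rB] => u Wu up e.
have -> : b = val (seq.last u p) by rewrite -e.
elim: p u Wu up {e} => [|v p IH] u Wu //= /andP[/asboolP uv vp].
apply: IH => //; apply: (cl (val u)) => //; first exact: valP.
exact: attached_adjacent uv.
Qed.

(** * Integer translations and congruence classes *)

Definition displace (v : int * int * int) (b : block) : block :=
  Block (lengthwise_x b) (xb b + v.1.1) (yb b + v.1.2) (zb b + v.2).

Lemma displaceN (v : int * int * int) : cancel (displace v) (displace (- v)).
Proof. by case: v => [[x y] z] [b x' y' z']; rewrite /displace /= !addrK. Qed.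

Lemma displaceK (v : int * int * int) : cancel (displace (- v)) (displace v).
Proof. by move=> b; have := displaceN (- v) b; rewrite opprK. Qed.

Lemma overlap_displace (v : int * int * int) (b c : block) :
  overlap (displace v b) (displace v c) = overlap b c.
Proof. by rewrite /overlap /xlen /ylen /=; lia. Qed.

Lemma body_displace (R : realType) (v : int * int * int) (b : block) :
  translation (v.1.1%:~R, v.1.2%:~R, v.2%:~R) @` body R b =
  body R (displace v b).
Proof.
apply/seteqP; split.
  move=> _ [[[x y] z] [/= bx by_ bz] <-].
  split; rewrite /translation /=.
  - by move: bx; rewrite /xlen /= !intrD; lra.
  - by move: by_; rewrite /ylen /= !intrD; lra.
  - by move: bz; rewrite !intrD; lra.
move=> [[x y] z] [/= bx by_ bz].
exists (x - v.1.1%:~R, y - v.1.2%:~R, z - v.2%:~R); last first.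
  by rewrite /translation /= !subrK.
split=> /=.
- by move: bx; rewrite /xlen /= !intrD; lra.
- by move: by_; rewrite /ylen /= !intrD; lra.
- by move: bz; rewrite !intrD; lra.
Qed.

Lemma congruent_displace (R : realType) (v : int * int * int)
    (B C : {fset block}) :
  congruent R (displace v @` B)%fset C -> congruent R B C.
Proof.
move=> [g mg gE].
pose t : R * R * R := (v.1.1%:~R, v.1.2%:~R, v.2%:~R).
exists (g \o translation t).
  by apply: motion_comp => //; exact: motion_translation.
rewrite -gE; apply/seteqP; split => [_ [b bB <-]|_ [_ /imfsetP[b bB ->] <-]].
  exists (displace v b); first by rewrite /=; apply: in_imfset.
  by rewrite -body_displace image_comp.
by exists b => //; rewrite -body_displace image_comp.
Qed.

Lemma congruence_class_displace (R : realType) (v : int * int * int)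
    (B : {fset block}) :
  [set C | congruent R (displace v @` B)%fset C] = [set C | congruent R B C].
Proof.
apply/seteqP; split => C /=; first exact: congruent_displace.
move=> BC; apply: (congruent_displace R (- v)).
suff -> : (displace (- v) @` (displace v @` B))%fset = B by [].
apply/fsetP => x; apply/imfsetP/idP => [[_ /imfsetP[y yB ->] ->]|xB] /=.
  by rewrite displaceN.
by exists (displace v x); [exact: in_imfset|rewrite displaceN].
Qed.

(** * Normalised representatives and the final count *)

Definition grounded (n : nat) (o : bool) (B : {fset block}) : Prop :=
  [/\ spaced B, linked B, #|` B| = n, Block o 0 0 0 \in B &
      forall b, b \in B -> 0 <= zb b].

Lemma mem_displace (v : int * int * int) (B : {fset block}) (b : block) :
  (b \in displace v @` B)%fset = (displace (- v) b \in B).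
Proof.
apply/imfsetP/idP => [[c cB ->]|bB] /=; first by rewrite displaceN.
by exists (displace (- v) b); rewrite ?displaceK.
Qed.

Lemma spaced_displace (v : int * int * int) (B : {fset block}) :
  spaced B -> spaced (displace v @` B)%fset.
Proof.
move=> sB b c; rewrite !mem_displace => bB cB bc.
apply: (can_inj (displaceK v)); apply: sB => //.
by move: bc; rewrite /clash overlap_displace /= (inj_eq (addIr _)).
Qed.

Lemma linked_displace (v : int * int * int) (B : {fset block}) :
  linked B -> linked (displace v @` B)%fset.
Proof.
move=> lB r W; rewrite mem_displace => rB Wr cl b.
rewrite mem_displace => bB; rewrite -(displaceK v b).
apply: (lB (displace (- v) r) (fun c => W (displace v c))) => //=.
  by rewrite displaceK.
move=> c d Wc dB cd; apply: cl Wc _ _; first by rewrite mem_displace displaceN.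
by move: cd; rewrite /adjacent overlap_displace /= opprD addrACA subrr addr0.
Qed.

(** Translate the corner of a lowest block to the origin; its orientation gives [o]. *)
Lemma grounded_representative (R : realType) (n : nat) (B : {fset block}) :
  (0 < n)%N -> contiguous_buildings R n B ->
  exists o B0, grounded n o B0 /\
    [set C | congruent R B0 C] = [set C | congruent R B C].
Proof.
move=> n0 [bB cB nB].
have [b bB'] : exists b, b \in B by apply/fset0Pn; rewrite -cardfs_gt0 nB.
pose r := val [arg min_(i < [` bB'] ) zb (val i)]%O.
have rB : r \in B by exact: valP.
have rmin c : c \in B -> zb r <= zb c.
  move=> cB'; rewrite /r; case: arg_minP => //= i _ /(_ [` cB']); exact.
pose v : int * int * int := (- xb r, - yb r, - zb r).
exists (lengthwise_x r), (displace v @` B)%fset; split; last first.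
  exact: congruence_class_displace.
split.
- exact/spaced_displace/(spaced_building R).
- exact/linked_displace/(linked_contiguous R).
- by rewrite card_imfset //=; exact: can_inj (displaceN v).
- rewrite mem_displace (_ : displace _ _ = r) //.
  by case: (r) @v => ? x y z; rewrite /displace /= !opprK !add0r.
- by move=> c; rewrite mem_displace => /rmin /=; lia.
Qed.

(** The two orientations of the root are counted separately, and [2 / 55 <= 1] absorbs the sum. *)
Lemma grounded_count (R : realType) (n : nat) (X : seq {fset block}) :
  uniq X -> (forall B, B \in X -> exists o, grounded n o B) ->
  (size X)%:R <= (55 * growth_weight R) ^+ n.
Proof.
move=> uX XB; pose P (B : {fset block}) := Block true 0 0 0 \in B.
have bound o (Y : seq {fset block}) : uniq Y ->
    (forall B, B \in Y -> grounded n o B) ->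
    (size Y)%:R <= (55 * growth_weight R) ^+ n / 55.
  by move=> uY YB; apply: (rooted_count R n (Block o 0 0 0)).
have t1 : (size [seq B <- X | P B])%:R <= (55 * growth_weight R) ^+ n / 55.
  apply: (bound true); first exact: filter_uniq.
  by move=> B; rewrite mem_filter => /andP[PB /XB[k [? ? ? _ ?]]]; split.
have t2 : (size [seq B <- X | ~~ P B])%:R <= (55 * growth_weight R) ^+ n / 55.
  apply: (bound false); first exact: filter_uniq.
  move=> B; rewrite mem_filter => /andP[PB /XB[k]]; case: k => // -[_ _ _ oB _].
  by rewrite /P oB in PB.
have g0 : 0 <= (55 * growth_weight R) ^+ n.
  have [? _] := growth_weight_bound R; apply: exprn_ge0; lra.
rewrite -(count_predC P X) -!size_filter natrD.
set g := (_ ^+ n) in t1 t2 g0 *; lra.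
Qed.

Lemma T24_bound (R : realType) (n : nat) : (0 < n)%N ->
  (T24 R n)%:R <= (191 + 35 / 100) ^+ n :> R.
Proof.
move=> n0; have [g0 g1] := growth_weight_bound R.
apply: (@le_trans _ _ ((55 * growth_weight R) ^+ n)); last first.
  by apply: lerXn2r; rewrite // nnegrE; lra.
rewrite /T24; set T := (T in fset_set T).
have [finT|infT] := pselect (finite_set T); last first.
  (* [fset_set] of an infinite set is empty. *)
  rewrite /fset_set; case: pselect => // _.
  by rewrite cardfs0; apply: exprn_ge0; lra.
(* One grounded representative is chosen per class; it determines its class, so the choice is
   injective. *)
pose reps c := [set B0 : {fset block} |
  (exists k, grounded n k B0) /\ [set C | congruent R B0 C] = c].
pose rep c := xget fset0 (reps c).
have repP c : c \in fset_set T -> reps c (rep c).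
  rewrite in_fset_set // inE => -[B nB <-].
  have [k [B0 [kB0 B0B]]] := grounded_representative R n B n0 nB.
  by apply: xgetPex; exists B0; split=> //; exists k.
rewrite -(size_map rep); apply: grounded_count.
  rewrite map_inj_in_uniq; first exact: fset_uniq.
  by move=> c d /repP[_ cE] /repP[_ dE] cd; rewrite -cE -dE cd.
by move=> _ /mapP[c /repP[? _] ->].
Qed.

Theorem theorem3p3 (R : realType) : h24 R <= 191 + 35 / 100.
Proof.
have H0 : 0 < 191 + 35 / 100 :> R by lra.
rewrite /h24 -[leRHS]lnK ?posrE // ler_expR /s24.
(* Settles the degenerate cases: a divergent sequence, and [T24 R n = 0], where [ln 0] is 0 by
   convention. *)
have ln_ge0 : 0 <= ln (191 + 35 / 100) :> R by apply: ln_ge0; lra.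
set u := (fun n : nat => _).
(* The limit of a divergent sequence is [0]. *)
have [cu|/dvgP -> //] := pselect (cvg (u @ \oo)).
apply: limr_le => //; near=> n.
have n0 : (0 < n)%N by near: n; exact: nbhs_infty_gt.
rewrite /u ler_pdivrMr ?ltr0n // mulr_natr -lnXn //.
have [T0|T0] := posnP (T24 R n).
  by rewrite T0 ln0 // lnXn // mulrn_wge0.
by rewrite ler_ln ?posrE ?ltr0n ?exprn_gt0 ?T24_bound.
Unshelve. all: by end_near. Qed.
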